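(* Let $f:\mathbb{R}^d\to\mathbb{R}$ and let $\Pi$ be the probability distribution on $\mathbb{R}^d$ with Lebesgue density $\pi(\theta) = Z_\Pi^{-1}\exp(-f(\theta))$, where $Z_\Pi$ is the normalizing constant. Let $\alpha\in(0,+\infty)$ and let $C\in\mathbb{R}^{d\times d}$ be a symmetric positive-definite matrix. Suppose that the unique maximizer $\theta^*$ of $\pi$ exists and that for any $\theta\in\mathbb{R}^d$, $$f(\theta)\ge f(\theta^* ) + \frac{\alpha}{2}\left(\theta-\theta^*\right)^T C^{-1}\left(\theta-\theta^*\right).$$ Let $P$ be the Metropolis-Hastings independence kernel (see context) with target $\Pi$ and Gaussian proposal $Q=\mathrm{N}_d(\theta^*,\alpha^{-1}C)$, and let $$\epsilon_{\theta^*} = (2\pi)^{-d/2}\alpha^{d/2}\det(C)^{-1/2} Z_\Pi\exp(f(\theta^* )),$$ where the $\pi$ in $(2\pi)^{-d/2}$ is the numerical constant. Then for every lower semicontinuous metric $\rho$ on $\mathbb{R}^d$ and every integer $t\ge1$, $$\mathcal{W}_\rho\left(P^t(\theta^*,\cdot),\Pi\right) = (1-\epsilon_{\theta^*})^t\int\rho(\theta,\theta^* )\,d\Pi(\theta).$$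
   Context: Metropolis-Hastings independence (MHI) kernel on $\mathbb{R}^d$ with strictly positive target density $\pi$ and strictly positive proposal density $q$, where the proposal distribution $Q$ is assumed different from $\Pi$: let $a(\theta,\theta') = \min\left\{ \frac{\pi(\theta') q(\theta)}{\pi(\theta) q(\theta')}, 1\right\}$ and for measurable $B\subseteq\mathbb{R}^d$ $$P(\theta, B) = \int_B a(\theta,\theta') q(\theta')\, d\theta' + \delta_\theta(B)\left(1 - \int a(\theta,\theta') q(\theta')\, d\theta'\right),$$ where $\delta_\theta$ is the Dirac measure at $\theta$; $P^1=P$ and $P^t(\theta,B) = \int P(\theta,d\theta')P^{t-1}(\theta',B)$ for $t\ge 2$. Wasserstein distance: for a lower semicontinuous metric $\rho$ on $\mathbb{R}^d$ (lower semicontinuous on $\mathbb{R}^d\times\mathbb{R}^d$ with the Euclidean topology), $\mathcal{W}_\rho(\mu,\nu) = \inf_{\xi\in\mathcal{C}(\mu,\nu)}\int\rho\,d\xi$, where $\mathcal{C}(\mu,\nu)$ is the set of joint probability measures with marginals $\mu$ and $\nu$. Values in $[0,+\infty]$ are allowed. *)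

(* Defs.v *)
From HB Require Import structures.
From mathcomp Require Import all_boot all_order all_algebra.
From mathcomp Require Import all_classical all_reals all_analysis measurable_realfun.

Set Implicit Arguments.
Unset Strict Implicit.
Unset Printing Implicit Defensive.

Import Order.TTheory GRing.Theory Num.Theory.
Import numFieldNormedType.Exports.

Local Open Scope classical_set_scope.
Local Open Scope ring_scope.

(* R^d is 'cV[R]_d.  The library topology on matrices is the product (hence
   the Euclidean) topology; measurable sets are the Borel sets. *)
HB.instance Definition _ (R : realType) (m n : nat) :=
  @isMeasurable.Build (sigma_display (@open 'M[R]_(m, n))) 'M[R]_(m, n)
    <<s @open 'M[R]_(m, n) >> (@sigma_algebra0 _ setT _) (@sigma_algebraC _ _)
    (@sigma_algebra_bigcup _ setT _).

Section borel_matrix.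
Context {R : realType} {m n : nat}.

Lemma open_measurable_mx (A : set 'M[R]_(m, n)) : open A -> measurable A.
Proof. by move=> oA; exact: sub_sigma_algebra. Qed.

Lemma measurable_coord_mx (i : 'I_m) (j : 'I_n) :
  measurable_fun [set: 'M[R]_(m, n)] (fun M => M i j).
Proof.
apply: (measurability _ (RGenOpens.measurableE R)) => _ [_ [x [y ->]] <-].
rewrite setTI; apply: open_measurable_mx.
apply: open_comp; last exact: interval_open.
by move=> M _; exact: coord_continuous.
Qed.

Lemma open_mxE (A : set 'M[R]_(m, n)) : open A ->
  A = \bigcup_(k in [set k : 'M[rat]_(m, n) * nat |
        (ball (map_mx ratr k.1 : 'M[R]_(m, n)) (k.2.+1%:R^-1)) `<=` A])
      ball (map_mx ratr k.1 : 'M[R]_(m, n)) (k.2.+1%:R^-1).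
Proof.
move=> oA; apply/seteqP; split => [x Ax|x [k kA kx]]; last exact: kA.
have /nbhs_ballP[e /= e0 eA] : nbhs x A by apply: open_nbhs_nbhs.
have [k ke] : exists k : nat, k.+1%:R^-1 < e / 2.
  have e20 : 0 < e / 2 by rewrite divr_gt0.
  exists (Num.truncn (e / 2)^-1).
  by rewrite invf_plt ?posrE// truncnS_gt.
have r0 : (0 : R) < k.+1%:R^-1 by rewrite invr_gt0.
have rq i j : exists q : rat, `|x i j - ratr q| < k.+1%:R^-1.
  have [|q] := @rat_in_itvoo R (x i j - k.+1%:R^-1) (x i j + k.+1%:R^-1).
    by rewrite ltrBlDr -addrA ltrDl addr_gt0.
  by rewrite in_itv /= => qx; exists q; rewrite ltr_distlC.
pose q := \matrix_(i, j) sval (cid (rq i j)).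
have bq : ball (map_mx ratr q : 'M[R]_(m, n)) k.+1%:R^-1 x.
  split => // i j; rewrite !mxE /ball /= distrC.
  by case: cid.
exists (q, k) => //= y qy.
apply: eA; apply: (@le_ball _ _ _ (k.+1%:R^-1 + k.+1%:R^-1)).
  by rewrite [e]splitr lerD// ltW.
exact: ball_triangle (ball_sym bq) qy.
Qed.

Lemma measurable_fun_mx d (T : measurableType d) (g : T -> 'M[R]_(m, n)) :
  (forall i j, measurable_fun [set: T] (fun t => g t i j)) ->
  measurable_fun [set: T] g.
Proof.
move=> mg; apply: (measurability (@open 'M[R]_(m, n))) => //.
move=> _ [A oA <-]; rewrite setTI (open_mxE oA) preimage_bigcup.
rewrite bigcup_mkcond; apply: countable_bigcupT_measurable => [|[q k]] //.
case: ifPn => // _.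
rewrite (_ : _ @^-1` _ = \bigcap_(ij in [set: 'I_m * 'I_n])
    (fun t => g t ij.1 ij.2) @^-1` ball (ratr (q ij.1 ij.2) : R) k.+1%:R^-1).
  apply: fin_bigcap_measurable => // ij _; rewrite -[X in measurable X]setTI.
  by apply: mg => //; exact: measurable_ball.
apply/seteqP; split => t /=.
  by move=> [_ gt] [i j] _ /=; have := gt i j; rewrite mxE.
by move=> gt; split => [|i j]; [rewrite invr_gt0|rewrite mxE; exact: (gt (i, j))].
Qed.

End borel_matrix.

(* The instance declared in the library for \x is not found by unification. *)
Lemma sigma_finite_product d1 d2 (T1 : measurableType d1)
    (T2 : measurableType d2) (R : realType)
    (m1 : {sigma_finite_measure set T1 -> \bar R})
    (m2 : {sigma_finite_measure set T2 -> \bar R}) :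
  sigma_finite setT (m1 \x m2)%E.
Proof.
have /sigma_finiteP[F [TF ndF Foo]] := sigma_finiteT m1.
have /sigma_finiteP[G [TG ndG Goo]] := sigma_finiteT m2.
exists (fun n => F n `*` G n).
  rewrite -setXTT TF TG predeqE => -[x y]; split; last first.
    by move=> [n _ []/= ? ?]; split; exists n.
  move=> [/= [n _ Fnx] [k _ Gky]]; exists (maxn n k) => //; split.
  - by move: x Fnx; exact/subsetPset/ndF/leq_maxl.
  - by move: y Gky; exact/subsetPset/ndG/leq_maxr.
move=> k; have [? ?] := Foo k; have [? ?] := Goo k.
split; first exact: measurableX.
by rewrite product_measure1E// lte_mul_pinfty// ge0_fin_numE.
Qed.

Section lebesgue_measure_cV.
Context {R : realType}.
Local Open Scope ereal_scope.

Section cons.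
Context {n : nat}.

Definition cons_cV (p : R * 'cV[R]_n) : 'cV[R]_n.+1 := col_mx p.1%:M p.2.

Lemma cons_cV0 p : cons_cV p ord0 ord0 = p.1.
Proof.
rewrite /cons_cV mxE; case: fintype.splitP => // k _.
by rewrite mxE !ord1 eqxx mulr1n.
Qed.

Lemma cons_cVS p i : cons_cV p (lift ord0 i) ord0 = p.2 i ord0.
Proof.
by rewrite -rshift1; exact: col_mxEd.
Qed.

Lemma measurable_cons_cV : measurable_fun [set: R * 'cV[R]_n] cons_cV.
Proof.
apply: measurable_fun_mx => i j; rewrite /cons_cV.
under eq_fun do rewrite (mxE _ _ i j).
case: (fintype.split (i : 'I_(1 + n))) => k.
  by under eq_fun do rewrite mxE !ord1 eqxx mulr1n; exact: measurable_fst.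
exact: (measurableT_comp (measurable_coord_mx k j) measurable_snd).
Qed.

Definition uncons_cV (v : 'cV[R]_n.+1) : R * 'cV[R]_n :=
  (v ord0 ord0, dsubmx (v : 'cV[R]_(1 + n))).

Lemma cons_cVK : cancel cons_cV uncons_cV.
Proof.
move=> [x v]; rewrite /uncons_cV /cons_cV /= col_mxKd; congr pair.
exact: (cons_cV0 (x, v)).
Qed.

Lemma measurable_uncons_cV : measurable_fun [set: 'cV[R]_n.+1] uncons_cV.
Proof.
apply/measurable_fun_pairP; split; first exact: measurable_coord_mx.
apply: measurable_fun_mx => i j /=.
by under eq_fun do rewrite mxE; exact: measurable_coord_mx.
Qed.

Variable mu : {sigma_finite_measure set 'cV[R]_n -> \bar R}.

Definition cons_measure : set 'cV[R]_n.+1 -> \bar R :=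
  pushforward (@lebesgue_measure R \x mu) cons_cV.

Let cons_measure0 : cons_measure set0 = 0.
Proof. by rewrite /cons_measure /pushforward preimage_set0 measure0. Qed.

Let cons_measure_ge0 A : 0 <= cons_measure A.
Proof. by apply: integral_ge0 => x _; exact: measure_ge0. Qed.

Let cons_measure_sigma_additive : semi_sigma_additive cons_measure.
Proof.
move=> F mF tF mUF; rewrite /cons_measure /pushforward preimage_bigcup.
apply: measure_semi_sigma_additive.
- by move=> k; rewrite -[X in measurable X]setTI; exact: measurable_cons_cV.
- apply/trivIsetP => /= i j _ _ ij; rewrite -preimage_setI.
  by move/trivIsetP : tF => /(_ _ _ _ _ ij) ->//; rewrite preimage_set0.
- rewrite -preimage_bigcup -[X in measurable X]setTI.
  exact: measurable_cons_cV.
Qed.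

HB.instance Definition _ := isMeasure.Build _ _ _ cons_measure
  cons_measure0 cons_measure_ge0 cons_measure_sigma_additive.

Let cons_measure_sigma_finite : sigma_finite setT cons_measure.
Proof.
have [F TF Foo] := sigma_finite_product (@lebesgue_measure R) mu.
exists (fun k => uncons_cV @^-1` F k).
  by rewrite -preimage_bigcup -TF preimage_setT.
move=> k; have [mF Fk] := Foo k; split.
  by rewrite -[X in measurable X]setTI; exact: measurable_uncons_cV.
rewrite /cons_measure /pushforward -comp_preimage (_ : _ \o _ = id) //.
by apply/funext => p /=; rewrite cons_cVK.
Qed.

HB.instance Definition _ := Measure_isSigmaFinite.Build _ _ _ cons_measure
  cons_measure_sigma_finite.

End cons.

(* Lebesgue measure on R^n as the n-fold product of the one on R; by
   lebesgue_cV_box it is the product of lengths on measurable boxes. *)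
Fixpoint lebesgue_cV (n : nat) : {sigma_finite_measure set 'cV[R]_n -> \bar R} :=
  match n with
  | 0 => \d_(0%R : 'cV[R]_0)
  | n'.+1 => cons_measure (lebesgue_cV n')
  end.

Lemma lebesgue_cV_box n (A : 'I_n -> set R) : (forall i, measurable (A i)) ->
  lebesgue_cV n [set v | forall i, A i (v i ord0)] =
  \prod_(i < n) lebesgue_measure (A i).
Proof.
elim: n A => [|n IH] A mA.
  by rewrite big_ord0 /= diracE mem_set// => -[].
rewrite big_ord_recl -(IH (fun i => A (lift ord0 i)))//.
pose B := [set v : 'cV[R]_n | forall i, A (lift ord0 i) (v i ord0)].
have mB : measurable B.
  rewrite (_ : B = \bigcap_(i in [set: 'I_n])
    (fun v : 'cV[R]_n => v i ord0) @^-1` A (lift ord0 i)).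
    apply: fin_bigcap_measurable => // i _; rewrite -[X in measurable X]setTI.
    exact: measurable_coord_mx.
  by apply/seteqP; split => v /= h i; [move=> _|]; exact: h.
rewrite -(product_measure1E lebesgue_measure (lebesgue_cV n) (mA ord0) mB) /=.
rewrite /= /cons_measure /pushforward; congr (_ _).
apply/seteqP; split => -[x v] /= h.
  split; first by have := h ord0; rewrite cons_cV0.
  by move=> i; have := h (lift ord0 i); rewrite cons_cVS.
move=> i; case: (unliftP ord0 i) => [j|] ->.
  by rewrite cons_cVS; exact: h.2.
by rewrite cons_cV0; exact: h.1.
Qed.

End lebesgue_measure_cV.

Section wasserstein.
Context {d} {T : measurableType d} {R : realType}.
Implicit Types (mu nu : set T -> \bar R) (rho : T -> T -> R).
Local Open Scope ereal_scope.

Definition coupling mu nu : set (probability (T * T)%type R) :=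
  [set xi | forall A, measurable A ->
    pushforward xi fst A = mu A /\ pushforward xi snd A = nu A].

Definition wasserstein rho mu nu : \bar R :=
  ereal_inf [set \int[xi]_z (rho z.1 z.2)%:E | xi in coupling mu nu].

End wasserstein.

(* Unlike metricType, this does not tie the metric to the topology of T. *)
Definition is_metric (T : Type) (R : realType) (rho : T -> T -> R) : Prop :=
  [/\ forall x y, 0 <= rho x y,
      forall x y, rho x y = 0 <-> x = y,
      forall x y, rho x y = rho y x
    & forall x y z, rho x z <= rho x y + rho y z].

Definition lsc_metric (T : topologicalType) (R : realType) (rho : T -> T -> R) :=
  is_metric rho /\ lower_semicontinuous (fun z : T * T => (rho z.1 z.2)%:E).

Definition unique_maximizer (T : Type) (R : realType) (g : T -> R) (x : T) :=
  (forall y, g y <= g x) /\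
  (forall x', (forall y, g y <= g x') -> x' = x).

Section quadratic_form.
Context {R : realType} {n : nat}.

Definition qform (M : 'M[R]_n) (x : 'cV[R]_n) : R := (x^T *m M *m x) 0 0.

Definition sym_posdef (M : 'M[R]_n) : Prop :=
  M^T = M /\ forall x, x != 0 -> 0 < qform M x.

Definition mvnormal_pdf (m : 'cV[R]_n) (S : 'M[R]_n) (x : 'cV[R]_n) : R :=
  (2 * pi) `^ (- (n%:R / 2)) * (\det S) `^ (- 2^-1) *
  expR (- (qform (invmx S) (x - m) / 2)).

End quadratic_form.

Section densities.
Context {R : realType} {n : nat}.
Implicit Types (f p q : 'cV[R]_n -> R).

Definition density_distribution p (B : set 'cV[R]_n) : \bar R :=
  (\int[lebesgue_cV n]_(x in B) (p x)%:E)%E.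

Definition normalizing_constant f : R :=
  fine (\int[lebesgue_cV n]_x (expR (- f x))%:E)%E.

Definition gibbs_pdf f (x : 'cV[R]_n) : R :=
  (normalizing_constant f)^-1 * expR (- f x).

End densities.

Section kernels.
Context {R : realType} {n : nat}.
Implicit Types (p q : 'cV[R]_n -> R) (P : 'cV[R]_n -> set 'cV[R]_n -> \bar R).
Local Open Scope ereal_scope.

Definition mhi_accept p q (x y : 'cV[R]_n) : R :=
  Num.min (p y * q x / (p x * q y))%R 1%R.

Definition mhi_kernel p q (x : 'cV[R]_n) (B : set 'cV[R]_n) : \bar R :=
  \int[lebesgue_cV n]_(y in B) (mhi_accept p q x y * q y)%:E +
  \d_x B * (1 - \int[lebesgue_cV n]_y (mhi_accept p q x y * q y)%:E).

(* The value at t = 0, the identity kernel, is only a convention. *)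
Fixpoint kernel_iter P (t : nat) (x : 'cV[R]_n) (B : set 'cV[R]_n) : \bar R :=
  match t with
  | 0 => \d_x B
  | 1 => P x B
  | t'.+1 => \int[P x]_y kernel_iter P t' y B
  end.

End kernels.

(* Main.v *)
(** At the mode the growth condition says exactly that the acceptance ratio
    [pi(y) q(theta_star) / (pi(theta_star) q(y))] is at most 1, so that
    [P(theta_star, .) = eps Pi + (1 - eps) delta] with
    [eps = q(theta_star) / pi(theta_star)]; [eps <= 1] because the Gaussian
    proposal has total mass 1.  Since [Pi] is invariant, iterating gives
    [P^t(theta_star, .) = (1 - c) Pi + c delta] with [c = (1 - eps) ^ t].
    The Wasserstein distance from such a mixture to [Pi] is
    [c * int rho(., theta_star) dPi]: keeping the common part of mass [1 - c] in
    place is a coupling of that cost, and testing any coupling against the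
    1-Lipschitz functions [min(rho(., theta_star), n)] gives the matching lower
    bound; the truncation covers the case of an infinite integral. *)

Require Import Defs.
From HB Require Import structures.
From mathcomp Require Import all_boot all_order all_algebra.
From mathcomp Require Import all_classical all_reals all_analysis.
From mathcomp Require Import measurable_realfun.
From mathcomp Require Import ring lra.

Set Implicit Arguments.
Unset Strict Implicit.
Unset Printing Implicit Defensive.

Import Order.TTheory GRing.Theory Num.Theory.
Import numFieldNormedType.Exports.

Local Open Scope classical_set_scope.
Local Open Scope ring_scope.

(** * Gaussian integrals over R^n *)

Section schur_complement.
Context {R : realType} {n : nat}.
Implicit Types (A : 'M[R]_(1 + n)) (v : 'cV[R]_n).

(** The Schur complement of the top-left entry. The top-right block is written as the transpose of
    the bottom-left one, which is correct for the symmetric matrices considered here. *)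
Definition schur A : 'M[R]_n :=
  drsubmx A - (A 0 0)^-1 *: (dlsubmx A *m (dlsubmx A)^T).

Lemma qformE m (M : 'M[R]_m) x :
  qform M x = \sum_j (\sum_i x i 0 * M i j) * x j 0.
Proof.
rewrite /qform mxE; apply: eq_bigr => j _; rewrite mxE; congr (_ * _).
by apply: eq_bigr => i _; rewrite mxE.
Qed.

Lemma sym_posdef_diag_gt0 A : sym_posdef A -> 0 < A 0 0.
Proof.
move=> [_ A0]; have := A0 (delta_mx 0 0).
rewrite /qform trmx_delta -rowE -colE !mxE; apply.
by apply/eqP => /matrixP/(_ 0 0); rewrite !mxE !eqxx => /eqP; rewrite oner_eq0.
Qed.

Lemma sym_posdef_block A : A^T = A ->
  A = block_mx (A 0 0)%:M (dlsubmx A)^T (dlsubmx A) (drsubmx A).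
Proof.
move=> sA; rewrite -[LHS]submxK; congr block_mx.
  apply/matrixP => i j; rewrite !ord1 !mxE mulr1n; congr (A _ _); exact/val_inj.
by rewrite -[in LHS]sA trmx_dlsub.
Qed.

(* Completing the square in the first coordinate. *)
Lemma qform_schur A x v : sym_posdef A ->
  qform A (col_mx x%:M v) =
  A 0 0 * (x + (A 0 0)^-1 * ((dlsubmx A)^T *m v) 0 0) ^+ 2 + qform (schur A) v.
Proof.
move=> pA; have a0 := sym_posdef_diag_gt0 pA.
rewrite /schur /qform [in LHS](sym_posdef_block pA.1).
set b := dlsubmx A; set D := drsubmx A.
rewrite tr_col_mx mul_row_block mul_row_col tr_scalar_mx.
rewrite mulmxBr mulmxBl -!scalemxAr -!scalemxAl !mulmxA.
have [c bv vb] : exists2 c, b^T *m v = c%:M & v^T *m b = c%:M.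
  exists ((b^T *m v) 0 0); first exact: mx11_scalar.
  by rewrite [LHS]mx11_scalar -[in LHS](trmxK b) -trmx_mul mxE.
rewrite !mulmxDl vb -!(mulmxA _ b^T) bv !mul_scalar_mx -!scalemxAl.
rewrite !mul_scalar_mx.
move: (v^T *m D *m v) => q.
rewrite !mxE !eqxx !mulr1n /=.
by field; exact: lt0r_neq0.
Qed.

(** One step of Gaussian elimination: [A] factors into a unit lower triangular block matrix and an
    upper triangular one with diagonal blocks [A 0 0] and [schur A]. *)
Lemma det_schur A : sym_posdef A -> \det A = A 0 0 * \det (schur A).
Proof.
move=> pA; have a0 := sym_posdef_diag_gt0 pA.
have E : A = block_mx 1%:M 0 ((A 0 0)^-1 *: dlsubmx A) 1%:M *m
    block_mx (A 0 0)%:M (dlsubmx A)^T 0 (schur A).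
  rewrite mulmx_block !mul1mx !mul0mx !addr0.
  rewrite -scalemxAl mul_mx_scalar scalerA mulVf ?lt0r_neq0// scale1r.
  rewrite /schur -scalemxAl addrC subrK.
  exact: sym_posdef_block pA.1.
by rewrite [in LHS]E det_mulmx det_lblock det_ublock !det1 !mul1r det_scalar1.
Qed.

(** Choosing the first coordinate so that the completed square vanishes makes each value of the
    reduced form a value of [qform A] at a nonzero vector. *)
Lemma sym_posdef_schur A : sym_posdef A -> sym_posdef (schur A).
Proof.
move=> pA; split.
  rewrite /schur linearB/= linearZ/= trmx_mul trmxK.
  by rewrite trmx_drsub pA.1.
move=> v v0; set x := - ((A 0 0)^-1 * ((dlsubmx A)^T *m v) 0 0).
have := qform_schur x v pA; rewrite addNr expr0n/= mulr0 add0r => <-.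
apply: pA.2; apply: contra v0 => /eqP e.
by apply/eqP; have := congr1 dsubmx e; rewrite col_mxKd linear0.
Qed.

Lemma col_mx_cVB x v (m : 'cV[R]_(1 + n)) :
  col_mx x%:M v - m = col_mx (x - m 0 0)%:M (v - dsubmx m).
Proof.
rewrite -[in LHS](vsubmxK m) opp_col_mx add_col_mx; congr col_mx.
apply/matrixP => i j; rewrite !ord1 !mxE !mulr1n; congr (_ - m _ _).
exact/val_inj.
Qed.

End schur_complement.

Lemma sym_posdef_det_gt0 (R : realType) n (A : 'M[R]_n) :
  sym_posdef A -> 0 < \det A.
Proof.
elim: n A => [A _|n IH A pA]; first by rewrite det_mx00.
rewrite (det_schur pA) mulr_gt0 ?sym_posdef_diag_gt0// IH//.
exact: sym_posdef_schur.
Qed.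

(** By symmetry the form of the inverse at [x] is the form of [A] at [invmx A *m x]. *)
Lemma sym_posdef_inv (R : realType) n (A : 'M[R]_n) :
  sym_posdef A -> sym_posdef (invmx A).
Proof.
move=> pA; have uA : A \in unitmx.
  by rewrite unitmxE unitfE gt_eqF// sym_posdef_det_gt0.
split; first by rewrite trmx_inv pA.1.
move=> x x0; have -> : qform (invmx A) x = qform A (invmx A *m x).
  by rewrite /qform trmx_mul trmx_inv pA.1 -!mulmxA mulKVmx.
apply: pA.2; apply: contra x0 => /eqP e; apply/eqP.
by rewrite -[x](mulKVmx uA) e mulmx0.
Qed.

Lemma sym_posdefZ (R : realType) n (A : 'M[R]_n) a :
  0 < a -> sym_posdef A -> sym_posdef (a *: A).
Proof.
move=> a0 [sA pA]; split; first by rewrite linearZ/= sA.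
by move=> x x0; rewrite /qform -scalemxAr -scalemxAl mxE mulr_gt0// pA.
Qed.

Section gaussian_integral.
Context {R : realType}.
Local Open Scope ereal_scope.

(** Tonelli, with the first coordinate innermost, because that is the coordinate in which
    [qform_schur] completes the square. *)
Lemma ge0_integral_cons_cV n (g : 'cV[R]_n.+1 -> \bar R) :
  measurable_fun setT g -> (forall v, 0 <= g v) ->
  \int[lebesgue_cV n.+1]_v g v =
  \int[lebesgue_cV n]_v \int[lebesgue_measure]_x g (cons_cV (x, v)).
Proof.
move=> mg g0.
have mgc : measurable_fun setT (g \o cons_cV).
  exact: measurableT_comp mg measurable_cons_cV.
rewrite /= /cons_measure ge0_integral_pushforward//; last first.
  exact: measurable_cons_cV.
rewrite preimage_setT fubini_tonelli1//; last by move=> z; exact: g0.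
by apply: (@fubini_tonelli _ _ _ _ R lebesgue_measure (lebesgue_cV n) _ mgc) => z; exact: g0.
Qed.

Lemma measurable_qform n (A : 'M[R]_n) (m : 'cV[R]_n) :
  measurable_fun setT (fun v : 'cV[R]_n => qform A (v - m)%R).
Proof.
have mi i : measurable_fun setT (fun v : 'cV[R]_n => (v - m)%R i 0%R).
  under eq_fun do rewrite mxE.
  by apply: measurable_funD => //; exact: measurable_coord_mx.
under eq_fun do rewrite qformE.
apply: measurable_sum => j; apply: measurable_funM => //.
by apply: measurable_sum => i; exact: measurable_funM.
Qed.

Lemma measurable_expR_qform n (A : 'M[R]_n) (m : 'cV[R]_n) :
  measurable_fun setT (fun v : 'cV[R]_n => expR (- (qform A (v - m) / 2))%R).
Proof.
apply: measurableT_comp => //; apply: measurableT_comp => //.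
by apply: measurable_funM => //; exact: measurable_qform.
Qed.

(** Up to its peak constant, the integrand is the normal density with mean [- c] and variance
    [a^-1], which has total mass 1. *)
Lemma integral_expR_sqr (a c : R) : (0 < a)%R ->
  \int[lebesgue_measure]_x (expR (- (a * (x + c) ^+ 2 / 2))%R)%:E =
  (Num.sqrt (2 * pi / a))%:E.
Proof.
move=> a0; pose s := Num.sqrt a^-1.
have s0 : s != 0%R by rewrite gt_eqF// sqrtr_gt0 invr_gt0.
have s2 : (s ^+ 2 = a^-1)%R by rewrite sqr_sqrtr// invr_ge0 ltW.
have pk : (Num.sqrt (2 * pi / a) = (normal_peak s)^-1)%R.
  rewrite /normal_peak invrK s2; congr Num.sqrt.
  by rewrite -mulr_natr; ring.
have := integral_normal_pdf (- c)%R s; rewrite normal_pdfE//.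
have pdfE x : (normal_peak s * normal_fun (- c) s x)%:E =
    (normal_peak s)%:E * (expR (- (a * (x + c) ^+ 2 / 2))%R)%:E.
  rewrite -EFinM /normal_fun; congr (_ * expR _)%:E.
  rewrite opprK s2; field; exact: lt0r_neq0.
under eq_integral do rewrite pdfE.
rewrite ge0_integralZl_EFin//; last 2 first.
- apply/measurable_EFinP; apply: measurableT_comp => //.
  apply: measurableT_comp => //; apply: measurable_funM => //.
  apply: measurable_funM => //; apply: measurable_funX.
  exact: measurable_funD.
- exact: normal_peak_ge0.
move=> h; rewrite pk.
have pk0 : normal_peak s != 0%R by rewrite gt_eqF// normal_peak_gt0.
by rewrite -[RHS]mule1 -h muleA -EFinM mulVf// mul1e.
Qed.

(** Induction on the dimension: integrating out the first coordinate gives a one-dimensional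
    Gaussian factor and leaves the Gaussian of the Schur complement; the determinants multiply by
    [det_schur]. *)
Lemma integral_gaussian n (A : 'M[R]_n) (m : 'cV[R]_n) : sym_posdef A ->
  \int[lebesgue_cV n]_v (expR (- (qform A (v - m) / 2))%R)%:E =
  (Num.sqrt ((2 * pi) ^+ n / \det A))%:E.
Proof.
elim: n A m => [A m _|n IH A m pA].
  (* In dimension 0 the measure is a unit point mass and both sides are 1. *)
  rewrite det_mx00 expr0 divr1 sqrtr1 /= integral_dirac//; last first.
    by apply/measurable_EFinP; exact: measurable_expR_qform.
  by rewrite diracT mul1e qformE big_ord0 mul0r oppr0 expR0.
have a0 := sym_posdef_diag_gt0 pA.
have pS := sym_posdef_schur pA.
rewrite ge0_integral_cons_cV//; last first.
  by apply/measurable_EFinP; exact: measurable_expR_qform.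
pose m' : 'cV[R]_n := dsubmx (m : 'cV[R]_(1 + n)).
transitivity (\int[lebesgue_cV n]_v ((Num.sqrt (2 * pi / A 0 0))%:E *
    (expR (- (qform (schur A) (v - m') / 2))%R)%:E)).
  apply: eq_integral => v _.
  (* The shift in the completed square, including the centring by [m 0 0]; it depends on [v] only,
     so the inner integral does not depend on it. *)
  pose c := ((A 0 0)^-1 * ((dlsubmx (A : 'M[R]_(1 + n)))^T *m (v - m')) 0 0 - m 0 0)%R.
  rewrite -(integral_expR_sqr c a0) -ge0_integralZr//; last first.
    apply/measurable_EFinP; apply: measurableT_comp => //.
    apply: measurableT_comp => //; apply: measurable_funM => //.
    apply: measurable_funM => //; apply: measurable_funX.
    exact: measurable_funD.
  apply: eq_integral => x _; rewrite -EFinM -expRD; congr (expR _)%:E.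
  have -> : (cons_cV (x, v) - m = col_mx (x - m 0 0)%:M (v - m'))%R.
    exact: (@col_mx_cVB _ _ x v m).
  rewrite qform_schur// /c -[in RHS]opprD -[in RHS]mulrDl; congr (- (_ / _))%R.
  by congr (_ * _ ^+ 2 + _)%R; rewrite addrCA addrC.
rewrite ge0_integralZl_EFin//; last first.
  by apply/measurable_EFinP; exact: measurable_expR_qform.
rewrite IH// -EFinM -sqrtrM; last first.
  by apply: divr_ge0; [rewrite mulr_ge0// pi_ge0|exact: ltW].
congr (Num.sqrt _)%:E; rewrite (det_schur pA) exprS.
have d0 := lt0r_neq0 (sym_posdef_det_gt0 pS).
by field; rewrite d0 lt0r_neq0.
Qed.

Lemma measurable_mvnormal_pdf n (S : 'M[R]_n) (m : 'cV[R]_n) :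
  measurable_fun setT (mvnormal_pdf m S).
Proof. by apply: measurable_funM => //; exact: measurable_expR_qform. Qed.

Lemma integral_mvnormal_pdf n (S : 'M[R]_n) (m : 'cV[R]_n) : sym_posdef S ->
  \int[lebesgue_cV n]_x (mvnormal_pdf m S x)%:E = 1.
Proof.
move=> pS; have d0 := sym_posdef_det_gt0 pS.
have p0 : (0 < 2 * pi :> R)%R by rewrite mulr_gt0// pi_gt0.
rewrite /mvnormal_pdf; under eq_integral do rewrite EFinM.
rewrite ge0_integralZl_EFin//; last 2 first.
- by apply/measurable_EFinP; exact: measurable_expR_qform.
- by rewrite mulr_ge0// powR_ge0.
rewrite integral_gaussian; last exact: sym_posdef_inv.
rewrite det_inv invrK -EFinM !powRN powRrM powR_mulrn ?ltW//.
rewrite -powR12_sqrt; last by rewrite mulr_ge0 ?exprn_ge0// ltW.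
rewrite powRM ?exprn_ge0 ?ltW//.
rewrite powR12_sqrt ?exprn_ge0 ?ltW//.
by rewrite -invfM mulVf// mulf_neq0// gt_eqF// ?sqrtr_gt0 ?exprn_gt0 ?powR_gt0.
Qed.

End gaussian_integral.

(** * Measures with a density *)

Section density_measure.
Context d (T : measurableType d) (R : realType) (mu : {measure set T -> \bar R}).
Local Open Scope ereal_scope.

(** Nonnegativity and measurability are arguments so that the measure structure can be attached to
    the set function itself. *)
Definition density_measure (p : T -> R) of (forall x, 0 <= p x)%R &
    measurable_fun setT p : set T -> \bar R :=
  fun A => \int[mu]_(x in A) (p x)%:E.

Variables (p : T -> R) (p0 : forall x, (0 <= p x)%R).
Hypothesis mp : measurable_fun setT p.
Local Notation m := (density_measure p0 mp).

Let density_measure0 : m set0 = 0.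
Proof. exact: integral_set0. Qed.

Let density_measure_ge0 A : 0 <= m A.
Proof. by apply: integral_ge0 => x _; rewrite lee_fin. Qed.

Let density_measure_sigma_additive : semi_sigma_additive m.
Proof.
apply: semi_sigma_additive_nng_induced; last by move=> x; rewrite lee_fin.
exact/measurable_EFinP.
Qed.

HB.instance Definition _ := isMeasure.Build _ _ _ m
  density_measure0 density_measure_ge0 density_measure_sigma_additive.

Import HBNNSimple.

(** A simple function is a finite sum of multiples of indicators of its fibres, and for an indicator
    the identity is the definition of [m]. *)
Let ge0_integral_density_nnsfun (h : {nnsfun T >-> R}) :
  \int[m]_x (h x)%:E = \int[mu]_x ((h x)%:E * (p x)%:E).
Proof.
transitivity (\int[m]_x (\sum_(r \in range h)
    (r * \1_(h @^-1` [set r]) x)%:E)).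
  by apply: eq_integral => x _; rewrite fsumEFin// -fimfunE.
rewrite ge0_integral_fsum//; last 2 first.
- move=> r; apply/measurable_EFinP; exact: measurable_funM.
- by move=> r x _; rewrite EFinM nnfun_muleindic_ge0.
transitivity (\int[mu]_x (\sum_(r \in range h)
    ((r * \1_(h @^-1` [set r]) x)%:E * (p x)%:E))); last first.
  apply: eq_integral => x _; rewrite -ge0_mule_fsuml => [|r]; last first.
    by rewrite EFinM nnfun_muleindic_ge0.
  by rewrite fsumEFin// -fimfunE.
rewrite ge0_integral_fsum//; last 2 first.
- move=> r; apply/emeasurable_funM; apply/measurable_EFinP => //.
  exact: measurable_funM.
- move=> r x _; apply: mule_ge0; last by rewrite lee_fin.
  by rewrite EFinM nnfun_muleindic_ge0.
apply: eq_fsbigr => r /[!inE] -[x _ hx].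
have r0 : (0 <= r)%R by rewrite -hx.
rewrite integralZl_indic_nnsfun// integral_indic// setIT.
under [RHS]eq_integral do rewrite EFinM -muleA.
rewrite ge0_integralZl_EFin//; last 2 first.
- by move=> y _; rewrite mule_ge0 ?lee_fin.
- by apply/emeasurable_funM; apply/measurable_EFinP.
congr (_ * _); rewrite [LHS]integral_mkcond.
by apply: eq_integral => y _; rewrite epatch_indic muleC.
Qed.

(** Monotone convergence on both sides along an increasing approximation of [g] by simple
    functions. *)
Lemma ge0_integral_density (g : T -> \bar R) :
  measurable_fun setT g -> (forall x, 0 <= g x) ->
  \int[m]_x g x = \int[mu]_x (g x * (p x)%:E).
Proof.
move=> mg g0; pose h := nnsfun_approx measurableT mg.
have hg x : (EFin \o h n) x @[n --> \oo] --> g x.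
  by apply: cvg_nnsfun_approx => // y _; exact: g0.
have ndh x : {homo (fun n => (h n x)%:E) : a b / (a <= b)%N >-> a <= b}.
  by move=> a b ab; rewrite lee_fin; exact/lefP/nd_nnsfun_approx.
transitivity (limn (fun n => \int[m]_x (h n x)%:E)).
  rewrite -monotone_convergence//.
  - by apply: eq_integral => x _; apply/esym/cvg_lim => //; exact: hg.
  - by move=> n; exact/measurable_EFinP.
  - by move=> n x _; rewrite lee_fin.
under eq_fun do rewrite ge0_integral_density_nnsfun.
rewrite -monotone_convergence//.
- apply: eq_integral => x _; apply/cvg_lim => //.
  by apply: cvgeZr => //; exact: hg.
- by move=> n; apply/emeasurable_funM; apply/measurable_EFinP.
- by move=> n x _; rewrite mule_ge0 ?lee_fin.
- by move=> x _ a b ab; rewrite lee_wpmul2r ?lee_fin//; exact: ndh.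
Qed.

End density_measure.

(** * Wasserstein distance from a mixture with a point mass *)

Section wasserstein_dirac_mixture.
Context d (T : measurableType d) (R : realType).
Variables (Pi : probability T R) (x : T) (c : R).
Hypothesis c01 : (0 <= c <= 1)%R.
Local Open Scope ereal_scope.

Let c0 : (0 <= c)%R. Proof. by case/andP: c01. Qed.
Let onemc0 : (0 <= 1 - c)%R. Proof. by rewrite subr_ge0; case/andP: c01. Qed.
Let diag (y : T) : T * T := (y, y).
Let mdiag : measurable_fun setT diag. Proof. exact/measurable_fun_pair. Qed.
HB.instance Definition _ := isMeasurableFun.Build _ _ _ _ diag mdiag.

Let pairx (y : T) : T * T := (x, y).
Let mpairx : measurable_fun setT pairx. Proof. exact/measurable_fun_pair. Qed.
HB.instance Definition _ := isMeasurableFun.Build _ _ _ _ pairx mpairx.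

(* With probability [c] the two coordinates are [x] and an independent draw
   from [Pi]; otherwise both are the same draw from [Pi]. *)
Let xi : set (T * T) -> \bar R := measure_add
  (mscale (NngNum onemc0) (distribution Pi diag))
  (mscale (NngNum c0) (distribution Pi pairx)).
HB.instance Definition _ := Measure.on xi.
Let xi_setT : xi setT = 1.
Proof.
rewrite /xi measure_addE /= /mscale /= !probability_setT.
by rewrite !mule1 -EFinD subrK.
Qed.
HB.instance Definition _ := Measure_isProbability.Build _ _ _ xi xi_setT.

Variable rho : T -> T -> R.
Hypothesis rho_metric : is_metric rho.
Hypothesis mrho : measurable_fun setT (fun z : T * T => rho z.1 z.2).
(** Plain set functions, constrained on measurable sets only: [coupling] tests nothing else, and
    [kernel_iter] yields a bare set function. *)
Variables mu nu : set T -> \bar R.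
Hypothesis muE : forall A, measurable A ->
  mu A = (1 - c)%:E * Pi A + c%:E * \d_x A.
Hypothesis nuE : forall A, measurable A -> nu A = Pi A.

Let rho_ge0 y z : (0 <= rho y z)%R. Proof. by case: rho_metric. Qed.
Let mrhox : measurable_fun setT (fun y => rho y x).
Proof.
apply: (measurableT_comp mrho (g := fun y => (y, x))).
exact/measurable_fun_pair.
Qed.

Let xi_coupling : coupling mu nu xi.
Proof.
move=> A mA; rewrite muE// nuE//; split.
  rewrite /pushforward /= /xi measure_addE /= /mscale /=; congr (_ + _ * _).
  rewrite /distribution /pushforward -comp_preimage (_ : fst \o pairx = cst x)//.
  rewrite diracE preimage_cst; case: ifP => _; last exact: measure0.
  exact: probability_setT.
rewrite /pushforward /= /xi measure_addE /= /mscale /= /distribution /pushforward.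
rewrite (_ : diag @^-1` _ = A)// (_ : pairx @^-1` _ = A)//.
by rewrite -ge0_muleDl ?lee_fin// -EFinD subrK mul1e.
Qed.

Let integral_xi : \int[xi]_z (rho z.1 z.2)%:E = c%:E * \int[Pi]_y (rho y x)%:E.
Proof.
have mr : measurable_fun setT (fun z : T * T => (rho z.1 z.2)%:E).
  exact/measurable_EFinP.
have r0 (z : T * T) : 0 <= (rho z.1 z.2)%:E by rewrite lee_fin.
rewrite ge0_integral_measure_add//.
rewrite !ge0_integral_mscale//= !ge0_integral_pushforward//.
rewrite preimage_setT integral0_eq ?mule0 ?add0e; last first.
  by move=> y _ /=; congr (_%:E); case: rho_metric => _ h _ _; exact/h.
congr (_ * _); apply: eq_integral => y _ /=.
by case: rho_metric => _ _ + _ => ->.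
Qed.

(** Bounded, so its integral against [Pi] is finite and can be subtracted; zero at [x], so the point
    mass in [mu] contributes nothing. *)
Let phi (n : nat) (y : T) : R := Num.min (rho y x) n%:R.

Let phi_ge0 n y : (0 <= phi n y)%R.
Proof. by rewrite le_min rho_ge0 ler0n. Qed.

Let mphi n : measurable_fun setT (phi n).
Proof. exact: measurable_minr. Qed.

Let phi_lip n y z : (phi n z <= phi n y + rho y z)%R.
Proof.
have [_ _ rhoC rhoD] := rho_metric.
rewrite /phi; have := rhoD z y x; rewrite (rhoC z y) addrC => h.
have := rho_ge0 y z; rewrite /Num.min; do 2 case: ifP => ?; lra.
Qed.

(** Let I be the integral of [phi n] against [Pi]. Integrating [phi_lip] against [gamma] and reading
    off the marginals gives I <= (1 - c) I + cost, that is, c I <= cost. *)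
Let wasserstein_test_le n (gamma : probability (T * T)%type R) :
  coupling mu nu gamma ->
  c%:E * \int[Pi]_y (phi n y)%:E <= \int[gamma]_z (rho z.1 z.2)%:E.
Proof.
move=> g; have mphin : measurable_fun setT (fun y => (phi n y)%:E).
  exact/measurable_EFinP.
have phi0 y : 0 <= (phi n y)%:E by rewrite lee_fin.
have mphi1 : measurable_fun setT (fun z : T * T => (phi n z.1)%:E).
  exact: measurableT_comp mphin measurable_fst.
have mphi2 : measurable_fun setT (fun z : T * T => (phi n z.2)%:E).
  exact: measurableT_comp mphin measurable_snd.
have mr : measurable_fun setT (fun z : T * T => (rho z.1 z.2)%:E).
  exact/measurable_EFinP.
have r0 (z : T * T) : 0 <= (rho z.1 z.2)%:E by rewrite lee_fin.
have marg2 : \int[gamma]_z (phi n z.2)%:E = \int[Pi]_y (phi n y)%:E.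
  transitivity (\int[pushforward gamma snd]_y (phi n y)%:E).
    by rewrite ge0_integral_pushforward// => y _; exact: phi0.
  apply: eq_measure_integral => A mA _.
  by have [_ h] := g _ mA; exact: etrans h (nuE mA).
have marg1 : \int[gamma]_z (phi n z.1)%:E = (1 - c)%:E * \int[Pi]_y (phi n y)%:E.
  transitivity (\int[pushforward gamma fst]_y (phi n y)%:E).
    by rewrite ge0_integral_pushforward// => y _; exact: phi0.
  rewrite (eq_measure_integral (measure_add (mscale (NngNum onemc0) Pi)
      (mscale (NngNum c0) \d_x))); last first.
    move=> A mA _; have [h _] := g _ mA; apply: (etrans h).
    by rewrite muE// -[RHS]/(measure_add _ _ A) measure_addE.
  rewrite ge0_integral_measure_add// !ge0_integral_mscale//=.
  rewrite integral_dirac// diracT mul1e /phi.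
  by have [_ h _ _] := rho_metric; rewrite (h x x).2//= min_l ?mule0 ?adde0.
have fin : \int[Pi]_y (phi n y)%:E \is a fin_num.
  rewrite ge0_fin_numE; last exact: integral_ge0.
  apply: (@le_lt_trans _ _ (\int[Pi]_y (cst n%:R%:E) y)).
    by apply: ge0_le_integral => // y _; rewrite lee_fin ge_min lexx orbT.
  rewrite integral_cst// lte_mul_pinfty ?lee_fin//.
  exact: le_lt_trans (probability_le1 Pi measurableT) (ltry _).
have : \int[gamma]_z (phi n z.2)%:E <=
    \int[gamma]_z (phi n z.1)%:E + \int[gamma]_z (rho z.1 z.2)%:E.
  rewrite -ge0_integralD//; apply: ge0_le_integral => //.
  - exact: emeasurable_funD.
  - by move=> z _; rewrite -EFinD lee_fin.
(* The cost may be infinite, in which case the bound is trivial; otherwise the inequality is between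
   reals. *)
rewrite marg1 marg2 -(fineK fin); move: (fine _) (\int[gamma]_z _) => I [J| |]//.
- by rewrite -!EFinM -EFinD !lee_fin => h; lra.
- by move=> _; rewrite leey.
Qed.

Lemma wasserstein_dirac_mixture :
  wasserstein rho mu nu = c%:E * \int[Pi]_y (rho y x)%:E.
Proof.
apply/eqP; rewrite eq_le; apply/andP; split.
  by apply: ereal_inf_lbound; exists xi; [exact: xi_coupling|exact: integral_xi].
apply: le_ereal_inf_tmp => _ [gamma hg <-].
rewrite -ge0_integralZl_EFin//; last 2 first.
- by move=> y _; rewrite lee_fin.
- exact/measurable_EFinP.
(* The truncations increase to the distance, so the lower bounds for each [n] pass to the limit by
   monotone convergence. *)
have cvgI : (\int[Pi]_y (c%:E * (phi n y)%:E)) @[n --> \oo] -->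
    \int[Pi]_y (c%:E * (rho y x)%:E).
  rewrite (_ : \int[Pi]_y (c%:E * (rho y x)%:E) =
      \int[Pi]_y (limn (fun n => c%:E * (phi n y)%:E))).
    apply: cvg_monotone_convergence => //.
    - by move=> n; apply: measurable_funeM; exact/measurable_EFinP.
    - by move=> n y _; rewrite mule_ge0 ?lee_fin.
    - move=> y _ a b ab; rewrite lee_wpmul2l ?lee_fin//.
      by rewrite le_min !ge_min lexx ler_nat ab orbT.
  apply: eq_integral => y _; apply/esym/cvg_lim => //; apply: cvg_near_cst.
  (* From this rank on the truncation at [y] is inactive and the sequence is constant. *)
  exists (Num.truncn (rho y x)).+1 => // n /= nr; congr (_ * _%:E).
  rewrite /phi min_l// (le_trans (ltW (truncnS_gt _)))// ler_nat//.
rewrite -(cvg_lim _ cvgI)//; apply: lime_le; first exact: cvgP cvgI.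
apply: nearW => n; rewrite ge0_integralZl_EFin//.
- exact: wasserstein_test_le.
- by move=> y _; rewrite lee_fin.
- exact/measurable_EFinP.
Qed.

End wasserstein_dirac_mixture.

(** * Measurability of lower semicontinuous functions on pairs of vectors *)

Section lower_semicontinuous_measurable.
Context {R : realType} {n : nat}.

(** Pairs carry the product sigma-algebra, not one generated by open sets. Packing a pair into a
    two-column matrix is measurable by coordinates, and it pulls the packed copy of [U], which is
    open and hence Borel, back to [U]. *)
Lemma open_measurable_cV2 (U : set ('cV[R]_n * 'cV[R]_n)) :
  open U -> measurable U.
Proof.
move=> oU.
pose pack (z : 'cV[R]_n * 'cV[R]_n) : 'M[R]_(n, 1 + 1) := row_mx z.1 z.2.
pose unpack (M : 'M[R]_(n, 1 + 1)) := (lsubmx M, rsubmx M).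
have mpack : measurable_fun setT pack.
  apply: measurable_fun_mx => i j; rewrite /pack.
  under eq_fun do rewrite mxE.
  case: (fintype.split j) => k.
    exact: measurableT_comp (measurable_coord_mx i k) measurable_fst.
  exact: measurableT_comp (measurable_coord_mx i k) measurable_snd.
have ounpack : open (unpack @^-1` U).
  rewrite openE => M UM; have /nbhs_ballP[e /= e0 eU] : nbhs (unpack M) U.
    exact: open_nbhs_nbhs.
  apply/nbhs_ballP; exists e => //= N [_ MN]; apply: eU.
  by split; split=> //= i j; rewrite !mxE; exact: MN.
have -> : U = pack @^-1` (unpack @^-1` U).
  rewrite -comp_preimage (_ : _ \o _ = id)//.
  by apply/funext => -[u v]; rewrite /unpack /pack /= row_mxKl row_mxKr.
rewrite -[X in measurable X]setTI; apply: mpack => //.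
exact: open_measurable_mx.
Qed.

Lemma lower_semicontinuous_measurable_cV2
    (g : 'cV[R]_n * 'cV[R]_n -> \bar R) :
  lower_semicontinuous g -> measurable_fun setT g.
Proof.
move=> /lower_semicontinuousP g_lsc.
apply: (measurability _ (ErealGenOInfty.measurableE R)) => _ [_ [a ->] <-].
rewrite preimage_itvoy; apply: measurableI => //.
by apply: open_measurable_cV2; exact: g_lsc.
Qed.

End lower_semicontinuous_measurable.

(** * The independence sampler *)

Section mhi_operator.
Context {R : realType} {n : nat}.
Variables p q : 'cV[R]_n -> R.
Hypotheses (p_gt0 : forall x, 0 < p x) (q_gt0 : forall x, 0 < q x).
Hypotheses (mp : measurable_fun setT p) (mq : measurable_fun setT q).
Hypothesis q1 : (\int[lebesgue_cV n]_x (q x)%:E = 1)%E.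
Local Open Scope ereal_scope.
Local Notation mu := (lebesgue_cV n).
Implicit Types (x y : 'cV[R]_n) (g : 'cV[R]_n -> \bar R).

(** The density of an accepted move from [x] to [y]; below, [r x] is the acceptance probability and
    [w x] the rejection probability. *)
Let s x y : R := (mhi_accept p q x y * q y)%R.

Let s_ge0 x y : (0 <= s x y)%R.
Proof.
rewrite mulr_ge0 ?le_min ?ler01 ?andbT ?ltW//.
by rewrite divr_gt0 ?mulr_gt0.
Qed.

Let s_le x y : (s x y <= q y)%R.
Proof. by apply: ler_piMl; [exact: ltW|rewrite ge_min lexx orbT]. Qed.

(** Both sides equal the minimum of [p y * q x] and [p x * q y], which is symmetric. *)
Let detailed_balance x y : (s x y * p x = s y x * p y)%R.
Proof.
have E u v : (s u v * p u = Num.min (p v * q u) (p u * q v))%R.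
  have puv : (0 < p u * q v)%R by rewrite mulr_gt0.
  rewrite /s /mhi_accept -mulrA [(q v * _)%R]mulrC minr_pMl ?ltW//.
  by rewrite divfK ?gt_eqF// mul1r.
by rewrite !E minC.
Qed.

Let ms : measurable_fun setT (fun z : 'cV[R]_n * 'cV[R]_n => s z.1 z.2).
Proof.
have mp1 := measurableT_comp mp (@measurable_fst _ _ _ 'cV[R]_n).
have mp2 := measurableT_comp mp (@measurable_snd _ _ 'cV[R]_n _).
have mq1 := measurableT_comp mq (@measurable_fst _ _ _ 'cV[R]_n).
have mq2 := measurableT_comp mq (@measurable_snd _ _ 'cV[R]_n _).
apply: measurable_funM => //; apply: measurable_minr => //.
apply: measurable_funM; first exact: measurable_funM.
(* Measurability of the reciprocal comes from that of the power -1, which agrees with the inverse on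
   nonnegative reals. *)
have mD : measurable_fun setT
    (fun z : 'cV[R]_n * 'cV[R]_n => (p z.1 * q z.2) `^ (-1))%R.
  apply: (measurableT_comp (measurable_powR _)); exact: measurable_funM.
by under eq_fun do rewrite -powR_inv1 ?mulr_ge0 ?ltW//.
Qed.

Let ms2 x : measurable_fun setT (s x).
Proof.
apply: (measurableT_comp ms (g := fun y => (x, y))).
exact/measurable_fun_pair.
Qed.

Let r x := \int[mu]_y (s x y)%:E.

Let r_le1 x : r x <= 1.
Proof.
rewrite -q1; apply: ge0_le_integral => //; try exact/measurable_EFinP.
all: by move=> y _; rewrite lee_fin//; exact: ltW.
Qed.

Let r_ge0 x : 0 <= r x.
Proof. by apply: integral_ge0 => y _; rewrite lee_fin. Qed.

(** Real-valued so that it can scale a Dirac measure; [r_le1] makes the acceptance probability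
    finite and this difference nonnegative. *)
Let w x : R := (1 - fine (r x))%R.

Let rE x : r x = (fine (r x))%:E.
Proof. by rewrite fineK// ge0_fin_numE// (le_lt_trans (r_le1 x))// ltry. Qed.

Let wE x : (w x)%:E = 1 - r x. Proof. by rewrite rE. Qed.

Let w_ge0 x : (0 <= w x)%R.
Proof. by rewrite subr_ge0 -lee_fin -rE. Qed.

(** The kernel acting on functions. Iterates of the kernel are studied as iterates of this operator
    on indicators. *)
Definition mhi_operator g x := \int[mu]_y (g y * (s x y)%:E) + g x * (w x)%:E.
Local Notation K := mhi_operator.

(** The set function [mhi_kernel p q x] equals a genuine measure, a density part plus a scaled Dirac
    mass, so integration against it splits. *)
Lemma integral_mhi_kernel g x : measurable_fun setT g ->
  (forall y, 0 <= g y) -> \int[mhi_kernel p q x]_y g y = K g x.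
Proof.
move=> mg g0.
have -> : mhi_kernel p q x =
    (measure_add (density_measure mu (s_ge0 x) (ms2 x))
                 (mscale (NngNum (w_ge0 x)) \d_x)).
  apply/funext => B; rewrite measure_addE /= /mscale /= wE muleC.
  by rewrite /mhi_kernel muleC.
rewrite ge0_integral_measure_add// ge0_integral_density//.
by rewrite ge0_integral_mscale// integral_dirac// diracT mul1e muleC.
Qed.

Lemma mhi_operator_ge0 g : (forall y, 0 <= g y) -> forall x, 0 <= K g x.
Proof.
move=> g0 x; rewrite adde_ge0 ?mule_ge0 ?lee_fin//.
by apply: integral_ge0 => y _; rewrite mule_ge0 ?lee_fin.
Qed.

Let measurable_gs g : measurable_fun setT g ->
  measurable_fun setT (fun z : 'cV[R]_n * 'cV[R]_n => g z.2 * (s z.1 z.2)%:E).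
Proof.
move=> mg; apply: emeasurable_funM; last exact/measurable_EFinP.
exact: measurableT_comp mg measurable_snd.
Qed.

Let measurable_intgs g : measurable_fun setT g -> (forall y, 0 <= g y) ->
  measurable_fun setT (fun x => \int[mu]_y (g y * (s x y)%:E)).
Proof.
move=> mg g0; apply: (@measurable_fun_fubini_tonelli_F _ _ _ _ R mu
  (fun z : 'cV[R]_n * 'cV[R]_n => g z.2 * (s z.1 z.2)%:E)).
  exact: measurable_gs.
by move=> z; rewrite mule_ge0 ?lee_fin.
Qed.

Let measurable_r : measurable_fun setT r.
Proof.
have := @measurable_intgs (cst 1) (measurable_cst _) (fun _ => lee01).
by under eq_fun do under eq_integral do rewrite mul1e.
Qed.

Let measurable_w : measurable_fun setT (EFin \o w).
Proof.
rewrite (_ : _ \o _ = fun x => 1 - r x); last by apply/funext => x /=; exact: wE.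
exact: emeasurable_funB.
Qed.

Lemma measurable_mhi_operator g : measurable_fun setT g ->
  (forall y, 0 <= g y) -> measurable_fun setT (K g).
Proof.
move=> mg g0; apply: emeasurable_funD; first exact: measurable_intgs.
exact: emeasurable_funM.
Qed.

(** Detailed balance and Tonelli turn the accepted part into the integral of [g * r * p]; the
    rejected part is that of [g * w * p], and [r] and [w] add up to 1. *)
Lemma mhi_operator_invariant g : measurable_fun setT g ->
  (forall y, 0 <= g y) ->
  \int[mu]_x (K g x * (p x)%:E) = \int[mu]_x (g x * (p x)%:E).
Proof.
move=> mg g0.
have mpE : measurable_fun setT (EFin \o p) by exact/measurable_EFinP.
have p0 x : 0 <= (p x)%:E by rewrite lee_fin ltW.
have s0 x y : 0 <= (s x y)%:E by rewrite lee_fin.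
have w0 x : 0 <= (w x)%:E by rewrite lee_fin.
transitivity (\int[mu]_x ((\int[mu]_y (g y * (s x y)%:E)) * (p x)%:E) +
              \int[mu]_x (g x * (w x)%:E * (p x)%:E)).
  rewrite -ge0_integralD//.
  - apply: eq_integral => x _; rewrite ge0_muleDl// ?mule_ge0//.
    by apply: integral_ge0 => y _; rewrite mule_ge0.
  - move=> x _; rewrite mule_ge0//.
    by apply: integral_ge0 => y _; rewrite mule_ge0.
  - by apply: emeasurable_funM => //; exact: measurable_intgs.
  - by move=> x _; rewrite !mule_ge0.
  - by apply: emeasurable_funM => //; exact: emeasurable_funM.
have -> : \int[mu]_x ((\int[mu]_y (g y * (s x y)%:E)) * (p x)%:E) =
    \int[mu]_y (g y * r y * (p y)%:E).
  (* Detailed balance moves the weight from [p x] to [p y]; after the swap of integrals the inner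
     one is [r y]. *)
  transitivity (\int[mu]_x \int[mu]_y (g y * (s y x * p y)%:E)).
    apply: eq_integral => x _; rewrite -ge0_integralZr//.
    - by apply: eq_integral => y _; rewrite -muleA -EFinM detailed_balance.
    - by apply: emeasurable_funM => //; exact/measurable_EFinP.
    - by move=> y _; rewrite mule_ge0.
  rewrite (fubini_tonelli (m1 := mu) (m2 := mu)
    (fun z : 'cV[R]_n * 'cV[R]_n => g z.2 * (s z.2 z.1 * p z.2)%:E))/=.
  - apply: eq_integral => y _; rewrite /r -ge0_integralZl//.
    + rewrite -ge0_integralZr//.
      * by apply: eq_integral => x _; rewrite EFinM muleA.
      * by apply: emeasurable_funM => //; exact/measurable_EFinP.
      * by move=> x _; rewrite mule_ge0.
    + exact/measurable_EFinP.
  - apply: emeasurable_funM.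
      exact: measurableT_comp mg measurable_snd.
    apply/measurable_EFinP; apply: measurable_funM.
      apply: (measurableT_comp ms (g := fun z => (z.2, z.1))).
      exact: measurable_swap.
    exact: measurableT_comp mp measurable_snd.
  - by move=> z; rewrite mule_ge0// lee_fin mulr_ge0// ltW.
rewrite -ge0_integralD//.
- apply: eq_integral => x _; rewrite -ge0_muleDl ?mule_ge0//.
  by rewrite -ge0_muleDr// wE addeC subeK ?mule1// rE.
- by move=> x _; rewrite !mule_ge0.
- by apply: emeasurable_funM => //; exact: emeasurable_funM.
- by move=> x _; rewrite !mule_ge0.
- by apply: emeasurable_funM => //; exact: emeasurable_funM.
Qed.

Lemma iter_mhi_operatorP g t : measurable_fun setT g -> (forall y, 0 <= g y) ->
  [/\ measurable_fun setT (iter t K g), forall y, 0 <= iter t K g y &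
      \int[mu]_x (iter t K g x * (p x)%:E) = \int[mu]_x (g x * (p x)%:E)].
Proof.
move=> mg g0; elim: t => // t [mK K0 KE]; split => /=.
- exact: measurable_mhi_operator.
- exact: mhi_operator_ge0.
- by rewrite mhi_operator_invariant.
Qed.

(** The exponent [t.+1] starts the induction at the branch where [kernel_iter] is the kernel itself;
    each further step integrates the induction hypothesis against the kernel. *)
Lemma kernel_iter_mhi t x (B : set 'cV[R]_n) : measurable B ->
  kernel_iter (mhi_kernel p q) t.+1 x B = iter t.+1 K (EFin \o \1_B) x.
Proof.
move=> mB; elim: t x => [x|t IH x].
  rewrite /= /mhi_operator wE muleC /mhi_kernel; congr (_ + _); last first.
    by rewrite muleC.
  rewrite integral_mkcond; apply: eq_integral => y _.
  by rewrite epatch_indic muleC.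
have mB1 : measurable_fun setT (EFin \o \1_B : 'cV[R]_n -> \bar R).
  by apply/measurable_EFinP; exact: measurable_indic.
have B10 y : 0 <= (EFin \o \1_B) y :> \bar R by rewrite lee_fin.
have [mK K0 _] := iter_mhi_operatorP t.+1 mB1 B10.
rewrite (iterS t.+1) -integral_mhi_kernel//.
by congr integral; apply/funext => y; exact: IH.
Qed.

Hypothesis p1 : \int[mu]_x (p x)%:E = 1.

(* Where the acceptance ratio from [x] is never truncated, the chain leaves [x]
   for an exact draw from the target with probability [q x / p x]. *)
Lemma kernel_iter_mhi_mode t x (B : set 'cV[R]_n) : measurable B ->
  (forall y, p y * q x <= p x * q y)%R ->
  kernel_iter (mhi_kernel p q) t.+1 x B =
  (1 - (1 - q x / p x) ^+ t.+1)%:E * \int[mu]_(y in B) (p y)%:E +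
  ((1 - q x / p x) ^+ t.+1)%:E * \d_x B.
Proof.
move=> mB xmode; rewrite kernel_iter_mhi//; set eps := (q x / p x)%R.
(* No truncation at [x]: the proposal density cancels and the accepted moves have density
   proportional to the target. *)
have sE y : s x y = (eps * p y)%R.
  rewrite /s /mhi_accept min_l.
    by rewrite /eps; field; rewrite !gt_eqF.
  by rewrite ler_pdivrMr ?mul1r// mulr_gt0.
have rxE : r x = eps%:E.
  rewrite /r; under eq_integral do rewrite sE EFinM.
  rewrite ge0_integralZl_EFin ?p1 ?mule1//.
  - by move=> y _; rewrite lee_fin ltW.
  - exact/measurable_EFinP.
  - by rewrite divr_ge0// ltW.
have mB1 : measurable_fun setT (EFin \o \1_B : 'cV[R]_n -> \bar R).
  by apply/measurable_EFinP; exact: measurable_indic.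
have B10 y : 0 <= (EFin \o \1_B) y :> \bar R by rewrite lee_fin.
set I := \int[mu]_(y in B) (p y)%:E.
have IE : \int[mu]_y ((EFin \o \1_B) y * (p y)%:E) = I.
  rewrite /I [RHS]integral_mkcond; apply: eq_integral => y _.
  by rewrite epatch_indic muleC.
have I_fin : I \is a fin_num.
  rewrite ge0_fin_numE; last by apply: integral_ge0 => y _; rewrite lee_fin ltW.
  apply: (@le_lt_trans _ _ (\int[mu]_y (p y)%:E)); last by rewrite p1 ltry.
  apply: ge0_subset_integral => //; first exact/measurable_EFinP.
  by move=> y _; rewrite lee_fin ltW.
have step g : measurable_fun setT g -> (forall y, 0 <= g y) ->
    K g x = eps%:E * \int[mu]_y (g y * (p y)%:E) + g x * (1 - eps)%:E.
  move=> mg g0; rewrite /mhi_operator wE rxE -EFinB; congr (_ + _).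
  rewrite -ge0_integralZl_EFin//.
  - by apply: eq_integral => y _; rewrite sE EFinM muleCA.
  - by move=> y _; rewrite mule_ge0// lee_fin ltW.
  - by apply: emeasurable_funM => //; exact/measurable_EFinP.
  - by rewrite divr_ge0// ltW.
elim: t => [|t IH].
  rewrite /= step// IE expr1 subKr; congr (_ + _).
  by rewrite muleC /= indicE diracE.
(* By invariance the target integral of every iterate is [I], so one more step maps a value V to eps
   I + (1 - eps) V. Since [I] is finite, the recursion closes by real algebra. *)
have [mK K0 KE] := iter_mhi_operatorP t.+1 mB1 B10.
rewrite (iterS t.+1) step// KE IE IH -(fineK I_fin) diracE.
rewrite -!EFinM -!EFinD; congr (_%:E).
by rewrite [(_ ^+ t.+2)%R]exprS; ring.
Qed.

End mhi_operator.

(** A zero integral would make [g] vanish almost everywhere, hence the whole space null; but the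
    space is a box whose sides are real lines of infinite length. This gives positivity of the
    normalizing constant. *)
Lemma integral_lebesgue_cV_gt0 (R : realType) n (g : 'cV[R]_n -> \bar R) :
  measurable_fun setT g -> (forall x, 0 < g x)%E ->
  (0 < \int[lebesgue_cV n]_x g x)%E.
Proof.
move=> mg g0; rewrite lt0e integral_ge0 ?andbT; last by move=> x _; exact: ltW.
apply/eqP => I0.
have : (\int[lebesgue_cV n]_x `|g x| = 0)%E.
  by rewrite -I0; apply: eq_integral => x _; rewrite gee0_abs// ltW.
move=> /(ae_eq_integral_abs _ measurableT mg).
move=> [N [mN N0 gN]].
have NT : N = setT.
  apply/seteqP; split => // x _; apply: gN => /= /(_ Logic.I) gx0.
  by have := g0 x; rewrite gx0 ltxx.
have NE : N = [set v : 'cV[R]_n | forall i, [set: R] (v i ord0)].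
  by rewrite NT; apply/seteqP; split.
have := lebesgue_cV_box (fun _ : 'I_n => @measurableT _ (measurableTypeR R)).
move/(etrans (congr1 (lebesgue_cV n) NE)).
rewrite N0 => /esym; apply/eqP; rewrite gt_eqF//.
apply: (big_ind (fun x : \bar R => 0 < x)%E) => [|x y|i _]; first exact: lte01.
  exact: mule_gt0.
by rewrite -set_itvNyy lebesgue_measure_itv/= ltry.
Qed.

(** * The Gaussian proposal centred at the mode *)

Theorem proposition2 (R : realType) (d : nat) (f : 'cV[R]_d -> R)
    (* exp (- f) is measurable with finite integral: pi is a density *)
    (f_int : (lebesgue_cV d).-integrable setT (fun x => (expR (- f x))%:E))
    (alpha : R) (alpha_gt0 : 0 < alpha)
    (C : 'M[R]_d) (C_posdef : sym_posdef C)
    (thetas : 'cV[R]_d)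
    (thetas_max : unique_maximizer (gibbs_pdf f) thetas)
    (f_growth : forall theta : 'cV[R]_d,
       f thetas + alpha / 2 * qform (invmx C) (theta - thetas) <= f theta)
    (* standing assumption: the proposal distribution differs from the target *)
    (Q_neq_Pi : exists2 B : set 'cV[R]_d, measurable B &
       density_distribution (mvnormal_pdf thetas (alpha^-1 *: C)) B <>
       density_distribution (gibbs_pdf f) B)
    (rho : 'cV[R]_d -> 'cV[R]_d -> R) (rho_metric : lsc_metric rho)
    (t : nat) (t_gt0 : (1 <= t)%N) :
  let P := mhi_kernel (gibbs_pdf f) (mvnormal_pdf thetas (alpha^-1 *: C)) in
  let Pi := density_distribution (gibbs_pdf f) in
  let eps := (2 * pi) `^ (- (d%:R / 2)) * alpha `^ (d%:R / 2) *
    (\det C) `^ (- 2^-1) * normalizing_constant f * expR (f thetas) in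
  wasserstein rho (kernel_iter P t thetas) Pi =
  (((1 - eps) ^+ t)%:E * \int[Pi]_theta (rho theta thetas)%:E)%E.
Proof.
move=> P Pi eps.
pose S := alpha^-1 *: C; pose p := gibbs_pdf f; pose q := mvnormal_pdf thetas S.
have ai0 : 0 < alpha^-1 by rewrite invr_gt0.
have pS : sym_posdef S by exact: sym_posdefZ.
have detC := sym_posdef_det_gt0 C_posdef.
have detS := sym_posdef_det_gt0 pS.
have uS : S \in unitmx by rewrite unitmxE unitfE gt_eqF.
have qformS x : qform (invmx S) x = alpha * qform (invmx C) x.
  by rewrite /qform /S invmxZ// invrK -scalemxAr -scalemxAl mxE.
have mef : measurable_fun setT (fun x => expR (- f x)).
  by apply/measurable_EFinP; exact: measurable_int f_int.
have IZ : (\int[lebesgue_cV d]_x (expR (- f x))%:E =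
    (normalizing_constant f)%:E)%E.
  by rewrite /normalizing_constant fineK//; exact: integrable_fin_num.
have Z0 : 0 < normalizing_constant f.
  rewrite -lte_fin -IZ; apply: integral_lebesgue_cV_gt0.
    exact/measurable_EFinP.
  by move=> x; rewrite lte_fin expR_gt0.
have p_gt0 x : 0 < p x by rewrite mulr_gt0 ?invr_gt0// expR_gt0.
have q_gt0 x : 0 < q x.
  by rewrite !mulr_gt0 ?expR_gt0// powR_gt0// mulr_gt0// pi_gt0.
have mp : measurable_fun setT p by exact: measurable_funM.
have mq : measurable_fun setT q by exact: measurable_mvnormal_pdf.
have q1 := integral_mvnormal_pdf thetas pS.
have p1 : (\int[lebesgue_cV d]_x (p x)%:E = 1)%E.
  rewrite /p /gibbs_pdf; under eq_integral do rewrite EFinM.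
  rewrite ge0_integralZl_EFin//.
  - by rewrite IZ -EFinM mulVf// gt_eqF.
  - exact/measurable_EFinP.
  - by rewrite invr_ge0 ltW.
pose k := (2 * pi) `^ (- (d%:R / 2)) * (\det S) `^ (- 2^-1).
have k0 : 0 < k by rewrite mulr_gt0// powR_gt0// mulr_gt0// pi_gt0.
have qk : q thetas = k.
  by rewrite /q /mvnormal_pdf subrr /qform mulmx0 mxE mul0r oppr0 expR0 mulr1.
(* The factor alpha^(d/2) comes from det(alpha^-1 C) = alpha^-d det C raised to the power -1/2. *)
have epsE : eps = q thetas / p thetas.
  rewrite qk /k /p /gibbs_pdf /S detZ.
  rewrite invfM invrK -[(expR (- _))^-1]expRN opprK mulrA.
  congr (_ * _); congr (_ * _); rewrite /eps -mulrA; congr (_ * _).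
  rewrite powRM ?exprn_ge0 ?ltW//; congr (_ * _).
  rewrite -powR_mulrn ?ltW// -powRrM -[X in _ = X `^ _]powR_inv1 ?ltW//.
  by rewrite -powRrM mulrN mulN1r opprK.
(* Once the normalizing constants cancel, comparing exponents leaves exactly [f_growth]. *)
have mode y : p y * q thetas <= p thetas * q y.
  rewrite qk /p /q /gibbs_pdf /mvnormal_pdf -/k qformS [leLHS]mulrAC.
  rewrite [leRHS]mulrACA ler_pM2l; last by apply: mulr_gt0; rewrite ?invr_gt0.
  rewrite -expRD ler_expR.
  have := f_growth y; lra.
have eps0 : 0 <= eps by rewrite epsE divr_ge0// ltW.
(* [mode] says that [eps * p] is at most [q] pointwise; both densities integrate to 1. *)
have eps1 : eps <= 1.
  have : (\int[lebesgue_cV d]_x (eps%:E * (p x)%:E) <=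
          \int[lebesgue_cV d]_x (q x)%:E)%E.
    apply: ge0_le_integral => //.
    - by move=> x _; rewrite -EFinM lee_fin mulr_ge0// ltW.
    - by apply/measurable_EFinP; exact: measurable_funM.
    - exact/measurable_EFinP.
    - move=> x _; rewrite -EFinM lee_fin epsE mulrAC ler_pdivrMr//.
      by rewrite mulrC [leRHS]mulrC; exact: mode.
  rewrite q1 ge0_integralZl_EFin//; last 2 first.
  - by move=> x _; rewrite lee_fin ltW.
  - exact/measurable_EFinP.
  by rewrite p1 mule1 lee_fin.
have p_ge0 x : 0 <= p x by exact: ltW.
pose Pi0 := density_measure (lebesgue_cV d) p_ge0 mp.
have Pi0T : Pi0 setT = 1%E by exact: p1.
(* The same set function as [Pi], equipped with its probability structure; the two agree by
   conversion. *)
pose Pi1 : probability 'cV[R]_d R :=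
  HB.pack Pi0 (Measure_isProbability.Build _ _ _ Pi0 Pi0T).
case: t t_gt0 => // t _.
apply: (@wasserstein_dirac_mixture _ _ R Pi1 thetas ((1 - eps) ^+ t.+1)) => //.
- by rewrite exprn_ge0 ?subr_ge0// exprn_ile1 ?subr_ge0// gerBl.
- exact: rho_metric.1.
- apply/measurable_EFinP; apply: lower_semicontinuous_measurable_cV2.
  exact: rho_metric.2.
- move=> A mA; rewrite /P epsE.
  exact: (kernel_iter_mhi_mode p_gt0 q_gt0 mp mq q1 p1 t mA mode).
Qed.
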